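(* Let $2\leqslant n\in\mathbb{N}^+$, $2\leqslant b\in\mathbb{N}^+$, $\tau\geqslant n-1$ (real) and $\alpha>0$. Then $$\mathcal{H}^{\tau+1}_{\log^\alpha}(\mathbb{T}^n)\subset \widetilde{\mathcal{L}^2_{\tau+1,b}}(\mathbb{T}^n)$$ if and only if $\alpha>1$.
   Context: $\mathbb{T}^n:=\mathbb{R}^n/2\pi\mathbb{Z}^n$. Functions are real mappings $f:\mathbb{T}^n\to\mathbb{R}^n$ with Fourier expansion $f(x)=\sum_{k\in\mathbb{Z}^n} f_k e^{\mathrm{i}\langle k,x\rangle}$, where $\langle k,x\rangle=\sum_{j=1}^n k_jx_j$ and $f_k=\int_{\mathbb{T}^n} f(x)e^{-\mathrm{i}\langle k,x\rangle}\,dx$ (the measure being normalized so that the expansion holds). For $k\in\mathbb{Z}^n$, $|k|:=\sum_{j=1}^n|k_j|$. Define $$\widetilde{\mathcal{L}^2_{\tau+1,b}}(\mathbb{T}^n):=\Big\{f:\ \sum_{\nu=0}^\infty\Big(\sum_{b^{\nu-1}<|k|\leqslant b^\nu}|f_k|^2|k|^{2\tau+2}\Big)^{1/2}<+\infty\Big\},$$ $$\mathcal{H}^{\tau+1}_{\log^\alpha}(\mathbb{T}^n):=\Big\{f:\ \Big(\sum_{k\in\mathbb{Z}^n}|f_k|^2|k|^{2\tau+2}\big(\ln(1+|k|)\big)^\alpha\Big)^{1/2}<+\infty\Big\}.$$ *)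

(* Defs.v *)
From HB Require Import structures.
From mathcomp Require Import all_boot all_order all_algebra.
From mathcomp Require Import all_classical all_reals all_analysis.
From mathcomp Require Import complex.

Import Order.TTheory GRing.Theory Num.Theory.
Import numFieldNormedType.Exports.

Local Open Scope classical_set_scope.
Local Open Scope ring_scope.
Local Open Scope complex_scope.

Section torus.
Context {R : realType}.

Lemma two_pi_gt0 : 0 < 2 * pi :> R.
Proof. by rewrite mulr_gt0// pi_gt0. Qed.

Definition consT {n : nat} (z : measurableTypeR R * n.-tuple R) : n.+1.-tuple R :=
  [tuple of z.1 :: z.2].

Lemma measurable_consT (n : nat) : measurable_fun setT (@consT n).
Proof. exact: measurable_cons. Qed.

HB.instance Definition _ (n : nat) :=
  isMeasurableFun.Build _ _ _ _ (@consT n) (@measurable_consT n).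

(* The normalized Lebesgue measure dx / (2 pi)^n on [0, 2 pi]^n, a fundamental
   domain of R^n / 2 pi Z^n, as the n-fold product of the uniform probability
   on [0, 2 pi]; it has total mass 1, the normalization for which
   f_k = \int f(x) e^{-i<k,x>} dx are the coefficients of the expansion
   f = \sum_k f_k e^{i<k,x>}. *)
Fixpoint haar (n : nat) : probability (n.-tuple R) R :=
  if n is n'.+1 then
    distribution (uniform_prob two_pi_gt0 \x haar n')%E (@consT n')
  else dirac [tuple].

(* A map T^n -> R^n is encoded by its lift to R^n, 2 pi-periodic in each
   variable. Square integrable maps are those that are the sum, in L^2, of
   their Fourier series. *)
Definition torus_map {n : nat} : set (n.-tuple R -> n.-tuple R) :=
  [set f | (forall (x : n.-tuple R) (m : n.-tuple int),
              f [tuple tnth x j + 2 * pi * (tnth m j)%:~R | j < n] = f x) /\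
           (forall j : 'I_n, (fun x => tnth (f x) j) \in Lfun (haar n) 2%:E)].

Definition expi (t : R) : R[i] := cos t +i* sin t.

Definition dotk {n : nat} (k : n.-tuple int) (x : n.-tuple R) : R :=
  \sum_(j < n) (tnth k j)%:~R * tnth x j.

Definition norm1 {n : nat} (k : n.-tuple int) : nat :=
  (\sum_(j < n) `|tnth k j|)%N.

Definition cintegral {n : nat} (g : n.-tuple R -> R[i]) : R[i] :=
  (\int[haar n]_x complex.Re (g x)) +i* (\int[haar n]_x complex.Im (g x)).

Definition fourier_coef {n : nat} (f : n.-tuple R -> n.-tuple R)
    (k : n.-tuple int) : 'rV[R[i]]_n :=
  \row_j cintegral (fun x => (tnth (f x) j)%:C * expi (- dotk k x)).

(* Hermitian norm on C^n *)
Definition cnorm {n : nat} (z : 'rV[R[i]]_n) : R :=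
  Num.sqrt (\sum_(j < n) ComplexField.Normc.normc (z 0 j) ^+ 2).

(* The exponent nu - 1 is taken in int: for nu = 0 the lower bound is 1 / b. *)
Definition shell (n b nu : nat) : set (n.-tuple int) :=
  [set k | b%:R ^ (nu%:Z - 1) < (norm1 k)%:R :> R /\
           (norm1 k)%:R <= b%:R ^+ nu :> R].

Definition L2tilde (n b : nat) (tau : R) : set (n.-tuple R -> n.-tuple R) :=
  [set f | torus_map f /\
    (\sum_(0 <= nu <oo)
       (\esum_(k in shell n b nu)
          (cnorm (fourier_coef f k) ^+ 2 *
           (norm1 k)%:R `^ (2 * tau + 2))%:E) `^ 2^-1 < +oo)%E].

Definition Hlog (n : nat) (tau alpha : R) : set (n.-tuple R -> n.-tuple R) :=
  [set f | torus_map f /\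
    ((\esum_(k in [set: n.-tuple int])
        (cnorm (fourier_coef f k) ^+ 2 *
         (norm1 k)%:R `^ (2 * tau + 2) *
         ln (1 + (norm1 k)%:R) `^ alpha)%:E) `^ 2^-1 < +oo)%E].

End torus.

(* Main.v *)
Require Import Defs.
From mathcomp Require Import all_boot all_order all_algebra.
From mathcomp Require Import all_classical all_reals all_analysis.
From mathcomp Require Import measurable_realfun complex lra ring zify.
Import Order.TTheory GRing.Theory Num.Theory.
Import numFieldNormedType.Exports.
Local Open Scope classical_set_scope.
Local Open Scope ring_scope.

(** Write s_nu for the sum over the shell b^(nu-1) < |k| <= b^nu of
    |f_k|^2 |k|^(2 tau + 2). The shells partition the nonzero frequencies and
    ln (1 + |k|) is comparable to nu + 1 on the shell of index nu. Hence the
    logarithmic norm asks that sum_nu s_nu (nu + 1)^alpha be finite, and the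
    other space asks that sum_nu s_nu^(1/2) be finite: the theorem compares two
    conditions on one sequence of nonnegative numbers.

    If alpha > 1, the arithmetic-geometric mean inequality gives
    s^(1/2) <= w s + 1 / w with w = (nu + 1)^alpha, and both
    sum_nu s_nu (nu + 1)^alpha and sum_nu (nu + 1)^(-alpha) converge
    ([Hlog_sub_L2tilde]).

    If alpha <= 1, a map is needed for which sum_nu s_nu^(1/2) diverges and
    sum_nu s_nu (nu + 1) converges. With H_nu the harmonic numbers, the
    Abel-Dini numbers c_nu = 1 / ((nu + 1) (1 + H_nu)) have sum c_nu infinite
    and sum c_nu^2 (nu + 1) finite, both by telescoping ([abel_dini_dvg],
    [abel_dini_sqr_le2]). They are realized by the lacunary series
    F(t) = sum_nu a_nu cos(b^nu t), a_nu = c_nu (b^nu)^(-(tau + 1)), used as a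
    function of the first coordinate of the torus: its only nonzero
    frequencies are (b^nu, 0, ..., 0) and (- b^nu, 0, ..., 0), one pair in each
    shell, and s_nu is a constant times c_nu^2. The Fourier coefficients come
    from Fubini on the product measure ([haar_tensor]), the orthogonality of
    trigonometric functions on [0, 2 pi] ([uniform_cos], [uniform_sin]), and
    dominated convergence ([cvg_integral_lacunary]). *)

Set Implicit Arguments.
Unset Strict Implicit.
Unset Printing Implicit Defensive.

(** * Bounded measurable functions *)

(** A class of integrands closed under products: all of them are integrable for
    every probability measure, which settles each integrability side condition
    below at once. *)
Definition bounded_measurable {d} {T : measurableType d} {R : realType}
    (f : T -> R) :=
  measurable_fun setT f /\ exists M : R, forall x, `|f x| <= M.

Section bounded_measurable.
Context {d} {T : measurableType d} {R : realType}.
Implicit Types f g : T -> R.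

Lemma bounded_measurable_cst (c : R) : bounded_measurable (fun _ : T => c).
Proof. by split; [exact: measurable_cst|exists `|c|]. Qed.

Lemma bounded_measurableD f g :
  bounded_measurable f -> bounded_measurable g ->
  bounded_measurable (fun x => f x + g x).
Proof.
move=> [mf [M fM]] [mg [N gN]]; split; first exact: measurable_funD.
by exists (M + N) => x; rewrite (le_trans (ler_normD _ _))// lerD.
Qed.

Lemma bounded_measurableM f g :
  bounded_measurable f -> bounded_measurable g ->
  bounded_measurable (fun x => f x * g x).
Proof.
move=> [mf [M fM]] [mg [N gN]]; split; first exact: measurable_funM.
by exists (M * N) => x; rewrite normrM ler_pM.
Qed.

Lemma bounded_measurable_comp {d'} {T' : measurableType d'} (h : T' -> T) f :
  measurable_fun setT h -> bounded_measurable f ->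
  bounded_measurable (fun x => f (h x)).
Proof.
move=> mh [mf [M fM]]; split; first exact: measurableT_comp.
by exists M.
Qed.

Lemma bounded_measurable_cos f :
  measurable_fun setT f -> bounded_measurable (fun x => cos (f x)).
Proof.
move=> mf; split; last by exists 1 => x; exact: cos_max.
apply: measurableT_comp => //.
by apply: continuous_measurable_fun; exact: continuous_cos.
Qed.

Lemma bounded_measurable_sin f :
  measurable_fun setT f -> bounded_measurable (fun x => sin (f x)).
Proof.
move=> mf; split; last by exists 1 => x; exact: sin_max.
apply: measurableT_comp => //.
by apply: continuous_measurable_fun; exact: continuous_sin.
Qed.

Lemma bounded_measurable_integrable (P : probability T R) f :
  bounded_measurable f -> P.-integrable setT (EFin \o f).
Proof.
move=> [mf [M fM]]; apply: measurable_bounded_integrable => //.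
  by apply: (le_lt_trans (probability_le1 P _)); rewrite ?ltry.
exists M; split; first exact: num_real.
by move=> x Mx t _ /=; rewrite (le_trans (fM t))// ltW.
Qed.

Lemma bounded_measurable_Lfun (P : probability T R) f :
  bounded_measurable f -> f \in Lfun P 2%:E.
Proof.
move=> [mf [M fM]]; rewrite inE; apply/andP; split; rewrite inE//=.
rewrite /finite_norm unlock poweR_lty//.
apply: (@le_lt_trans _ _ (\int[P]_x (cst (M `^ 2)%:E x))%E).
  apply: ge0_le_integral => //.
  - by move=> x _; rewrite lee_fin powR_ge0.
  - apply/measurable_EFinP.
    apply: (@measurableT_comp _ _ _ _ _ _ (@powR R ^~ 2)) => //.
    exact: measurableT_comp.
  - move=> x _ /=; rewrite lee_fin ge0_ler_powR// nnegrE//.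
    exact: le_trans (fM x).
rewrite integral_cst//; apply: (@le_lt_trans _ _ ((M `^ 2)%:E * 1)%E).
  by apply: lee_wpmul2l; [rewrite lee_fin powR_ge0|exact: probability_le1].
by rewrite mule1 ltry.
Qed.

Lemma Rintegral_probability_cst (P : probability T R) (c : R) :
  \int[P]_x c = c.
Proof. by rewrite Rintegral_cst//= (probability_setT P) mulr1. Qed.

End bounded_measurable.

Lemma measurable_mulr_const {R : realType} (c : R) :
  measurable_fun setT (fun t : R => c * t).
Proof. exact: measurable_funM. Qed.

(** * Trigonometric integrals over a period *)

Section uniform.
Context {R : realType}.
Local Notation unif := (uniform_prob (@two_pi_gt0 R)).

Lemma is_derive_trig (c x : R) :
  is_derive x 1 (fun t => sin (c * t)) (c * cos (c * x)) /\
  is_derive x 1 (fun t => cos (c * t)) (- c * sin (c * x)).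
Proof.
have dl : is_derive x 1 (fun t : R => c * t) c.
  have := @is_deriveZ _ _ _ id c x 1 1 (is_derive_id _ _).
  by rewrite /GRing.scale/= mulr1.
split.
- have := @is_derive1_comp R sin (fun t => c * t) x _ _
    (is_derive_sin _) dl.
  by rewrite mulrC.
- have := @is_derive1_comp R cos (fun t => c * t) x _ _
    (is_derive_cos _) dl.
  by rewrite mulrC mulrN mulNr.
Qed.

(** The change-of-density formula for the uniform law is for nonnegative
    integrands; shifting [h] by 1 reduces to that case. *)
Lemma uniform_FTC (h G : R -> R) : continuous h -> (forall t, `|h t| <= 1) ->
  (forall x : R, is_derive x 1 G (h x)) ->
  \int[unif]_x h x = (G (2 * pi) - G 0) / (2 * pi).
Proof.
move=> ch h1 dG.
have mh : measurable_fun setT h by exact: continuous_measurable_fun.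
have bh : bounded_measurable h by split => //; exists 1.
have b1 := @bounded_measurable_cst _ (measurableTypeR R) R 1.
have p0 := @two_pi_gt0 R.
have /eqP : \int[unif]_x (1 + h x) = 1 + (G (2 * pi) - G 0) / (2 * pi).
  rewrite /Rintegral integral_uniform//; last 2 first.
  - by apply/measurable_EFinP; exact: measurable_funD.
  - move=> x; rewrite lee_fin -lerBlDl sub0r.
    by have /ler_normlP[+ _] := h1 x; rewrite lerNl.
  have dH (x : R) : is_derive x 1 (fun t => t + G t) (1 + h x).
    exact: (@is_deriveD _ _ _ id G x 1 1 (h x) (is_derive_id _ _) (dG x)).
  rewrite (@continuous_FTC2 _ _ (fun t => t + G t))//.
  - rewrite -EFinB -EFinM /= subr0; have := p0; move: (2 * pi) => p {}p0.
    by field; rewrite gt_eqF.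
  - apply: continuous_subspaceT => x.
    by apply: cvgD; [exact: cvg_cst|exact: ch].
  - have cH : continuous (fun t => t + G t).
      move=> x; apply: differentiable_continuous.
      by apply/derivable1_diffP; case: (dH x).
    split.
    + by move=> x _; case: (dH x).
    + by apply: cvg_at_right_filter; exact: cH.
    + by apply: cvg_at_left_filter; exact: cH.
  - by move=> x _; rewrite derive1E; exact: (@derive_val _ _ _ _ _ _ _ (dH x)).
rewrite RintegralD//; [|exact: bounded_measurable_integrable..].
rewrite Rintegral_probability_cst => /eqP.
exact: addrI.
Qed.

Lemma sin_int_2pi (m : int) : sin (m%:~R * (2 * pi)) = 0 :> R.
Proof.
have H n : sin (n%:R * (2 * pi)) = 0 :> R.
  have := periodicn (@sinD2pi R) n 0.
  by rewrite add0r sin0 mulr_natl -[X in X *+ n]mulr_natl mulrC.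
case: m => n; first exact: H.
by rewrite NegzE mulrNz mulNr sinN H oppr0.
Qed.

Lemma cos_int_2pi (m : int) : cos (m%:~R * (2 * pi)) = 1 :> R.
Proof.
have H n : cos (n%:R * (2 * pi)) = 1 :> R.
  have := periodicn (@cosD2pi R) n 0.
  by rewrite add0r cos0 mulr_natl -[X in X *+ n]mulr_natl mulrC.
case: m => n; first exact: H.
by rewrite NegzE mulrNz mulNr cosN H.
Qed.

Lemma uniform_cos (m : int) :
  \int[unif]_t cos (m%:~R * t) = (m == 0)%:R.
Proof.
have [->|m0] := eqVneq m 0.
  under eq_Rintegral do rewrite mul0r cos0.
  by rewrite Rintegral_probability_cst.
have mR0 : m%:~R != 0 :> R by rewrite intr_eq0.
have dG (x : R) :
    is_derive x 1 (fun t => m%:~R^-1 * sin (m%:~R * t)) (cos (m%:~R * x)).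
  have := is_deriveZ m%:~R^-1 (is_derive_trig m%:~R x).1.
  by rewrite /GRing.scale/= mulrA mulVf// mul1r.
have ch : continuous (fun t : R => cos (m%:~R * t)).
  move=> x; apply: continuous_comp; last exact: continuous_cos.
  exact: mulrl_continuous.
rewrite (uniform_FTC ch _ dG); last by move=> t; exact: cos_max.
by rewrite sin_int_2pi !mulr0 sin0 !mulr0 subrr mul0r.
Qed.

Lemma uniform_sin (m : int) : \int[unif]_t sin (m%:~R * t) = 0.
Proof.
have [->|m0] := eqVneq m 0.
  under eq_Rintegral do rewrite mul0r sin0.
  by rewrite Rintegral_probability_cst.
have mR0 : m%:~R != 0 :> R by rewrite intr_eq0.
have dG (x : R) :
    is_derive x 1 (fun t => - m%:~R^-1 * cos (m%:~R * t)) (sin (m%:~R * x)).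
  have := is_deriveZ (- m%:~R^-1) (is_derive_trig m%:~R x).2.
  by rewrite /GRing.scale/= mulrA mulrNN mulVf// mul1r.
have ch : continuous (fun t : R => sin (m%:~R * t)).
  move=> x; apply: continuous_comp; last exact: continuous_sin.
  exact: mulrl_continuous.
rewrite (uniform_FTC ch _ dG); last by move=> t; exact: sin_max.
by rewrite cos_int_2pi mulr0 cos0 subrr mul0r.
Qed.

End uniform.

(** * Integration over the torus *)

Section haar.
Context {R : realType}.
Local Notation unif := (uniform_prob (@two_pi_gt0 R)).

(** Splits off the first coordinate, following the recursion that defines
    [haar]. *)
Lemma haar_Fubini n (f : n.+1.-tuple R -> R) : bounded_measurable f ->
  \int[haar n.+1]_x f x = \int[unif]_t \int[haar n]_y f (consT (t, y)).
Proof.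
move=> bf.
have bfc : bounded_measurable (f \o @consT R n).
  exact: (bounded_measurable_comp (@measurable_consT R n) bf).
have /= ifc := bounded_measurable_integrable (unif \x haar n)%E bfc.
rewrite /Rintegral /= integral_distribution//; last first.
  by apply/measurable_EFinP; case: bf.
rewrite -integral12_prod_meas1//; congr fine.
apply: eq_integral => t _; rewrite /fubini_F/= fineK//.
apply: integrable_fin_num => //.
apply: (bounded_measurable_integrable (haar n)).
apply: (bounded_measurable_comp _ bfc).
exact: measurable_pair1.
Qed.

Lemma measurable_dotk n (k : n.-tuple int) :
  measurable_fun setT (@dotk R n k).
Proof.
apply: measurable_sum => j; apply: measurable_funM => //.
exact: measurable_tnth.
Qed.

Lemma dotk_cons n (k0 : int) (k : n.-tuple int) (t : R) (y : n.-tuple R) :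
  dotk [tuple of k0 :: k] (consT (t, y)) = k0%:~R * t + dotk k y.
Proof.
rewrite /dotk big_ord_recl !tnth0; congr +%R.
by apply: eq_bigr => j _; rewrite !tnthS.
Qed.

Lemma norm1_cons n (k0 : int) (k : n.-tuple int) :
  norm1 [tuple of k0 :: k] = (`|k0| + norm1 k)%N.
Proof.
rewrite /norm1 big_ord_recl !tnth0; congr addn.
by apply: eq_bigr => j _; rewrite !tnthS.
Qed.

Let haar_trig_vanish n := forall k : n.-tuple int,
  \int[haar n]_x cos (dotk k x) = (norm1 k == 0%N)%:R :> R /\
  \int[haar n]_x sin (dotk k x) = 0 :> R.

(** The addition formulas separate the two factors, and the terms in
    sin <k, y> integrate to 0 by the hypothesis in dimension [n]. With [g = 1],
    the conclusion gives the same property in dimension [n.+1]. *)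
Let haar_tensor_rec n (g : R -> R) k0 (k : n.-tuple int) :
  haar_trig_vanish n -> bounded_measurable g ->
  \int[haar n.+1]_x (g (tnth x ord0) * cos (dotk [tuple of k0 :: k] x)) =
    (norm1 k == 0%N)%:R * \int[unif]_t (g t * cos (k0%:~R * t)) /\
  \int[haar n.+1]_x (g (tnth x ord0) * sin (dotk [tuple of k0 :: k] x)) =
    (norm1 k == 0%N)%:R * \int[unif]_t (g t * sin (k0%:~R * t)).
Proof.
move=> /(_ k)[Hc Hs] bg.
have bg0 : bounded_measurable (fun x : n.+1.-tuple R => g (tnth x ord0)).
  exact: (bounded_measurable_comp (measurable_tnth _) bg).
have bc := bounded_measurable_cos (@measurable_dotk n k).
have bs := bounded_measurable_sin (@measurable_dotk n k).
have ic := bounded_measurable_integrable (haar n) bc.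
have isn := bounded_measurable_integrable (haar n) bs.
have bcg := bounded_measurable_cos (measurable_mulr_const (k0%:~R : R)).
have bsg := bounded_measurable_sin (measurable_mulr_const (k0%:~R : R)).
have igc := bounded_measurable_integrable unif (bounded_measurableM bg bcg).
have igs := bounded_measurable_integrable unif (bounded_measurableM bg bsg).
have iZ (c : R) (h : n.-tuple R -> R) : bounded_measurable h ->
    (haar n).-integrable setT (EFin \o (fun y => c * h y)).
  move=> bh; apply: bounded_measurable_integrable.
  exact: bounded_measurableM (bounded_measurable_cst c) bh.
split; rewrite haar_Fubini//.
- rewrite -RintegralZl//; apply: eq_Rintegral => t _.
  transitivity (\int[haar n]_y (g t * cos (k0%:~R * t) * cos (dotk k y)
                - g t * sin (k0%:~R * t) * sin (dotk k y))).
    by apply: eq_Rintegral => y _; rewrite dotk_cons cosD tnth0 /=; ring.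
  rewrite RintegralB//; [|exact: iZ..].
  by rewrite !RintegralZl// Hc Hs; ring.
- apply: bounded_measurableM => //.
  exact: (bounded_measurable_cos (@measurable_dotk _ _)).
- rewrite -RintegralZl//; apply: eq_Rintegral => t _.
  transitivity (\int[haar n]_y (g t * sin (k0%:~R * t) * cos (dotk k y)
                + g t * cos (k0%:~R * t) * sin (dotk k y))).
    by apply: eq_Rintegral => y _; rewrite dotk_cons sinD tnth0 /=; ring.
  rewrite RintegralD//; [|exact: iZ..].
  by rewrite !RintegralZl// Hc Hs; ring.
- apply: bounded_measurableM => //.
  exact: (bounded_measurable_sin (@measurable_dotk _ _)).
Qed.

Lemma haar_trig n : haar_trig_vanish n.
Proof.
elim: n => [|n IH] k.
  have d0 x : dotk k x = 0 :> R by rewrite /dotk big_ord0.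
  rewrite /norm1 big_ord0 eqxx.
  under eq_Rintegral do rewrite d0 cos0.
  rewrite Rintegral_probability_cst; split => //.
  under eq_Rintegral do rewrite d0 sin0.
  by rewrite Rintegral_probability_cst.
case/tupleP: k => k0 k.
have b1 := @bounded_measurable_cst _ (measurableTypeR R) R 1.
have [] := haar_tensor_rec k0 k IH b1.
under eq_Rintegral do rewrite mul1r.
under [X in _ * X]eq_Rintegral do rewrite mul1r.
rewrite uniform_cos => ->.
under eq_Rintegral do rewrite mul1r.
under [X in _ * X]eq_Rintegral do rewrite mul1r.
rewrite uniform_sin mulr0 => ->; split => //.
by rewrite norm1_cons addn_eq0 absz_eq0 -natrM mulnb andbC.
Qed.

(** A function of the first coordinate sees only the frequencies supported on
    that coordinate. *)
Lemma haar_tensor n (g : R -> R) k0 (k : n.-tuple int) :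
  bounded_measurable g ->
  \int[haar n.+1]_x (g (tnth x ord0) * cos (dotk [tuple of k0 :: k] x)) =
    (norm1 k == 0%N)%:R * \int[unif]_t (g t * cos (k0%:~R * t)) /\
  \int[haar n.+1]_x (g (tnth x ord0) * sin (dotk [tuple of k0 :: k] x)) =
    (norm1 k == 0%N)%:R * \int[unif]_t (g t * sin (k0%:~R * t)).
Proof. by move=> bg; apply: haar_tensor_rec => //; exact: haar_trig. Qed.

End haar.

(** * Lacunary cosine series *)

Section lacunary_series.
Context {R : realType}.
Variables (b : nat) (a : R^nat).
Hypotheses (b_gt1 : (1 < b)%N) (a_ge0 : forall nu, 0 <= a nu).
Hypothesis cvg_a : cvgn (series a).
Local Notation unif := (uniform_prob (@two_pi_gt0 R)).

Let term t nu : R := a nu * cos ((b ^ nu)%:R * t).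

Definition lacunary (t : R) : R :=
  limn (series (fun nu => a nu * cos ((b ^ nu)%:R * t))).

Let norm_term t nu : `|term t nu| <= a nu.
Proof.
by rewrite normrM ger0_norm// ler_piMr// cos_max.
Qed.

Let cvg_lacunary t : series (term t) @ \oo --> lacunary t.
Proof.
apply: normed_cvg; apply: series_le_cvg cvg_a => nu //.
  exact: normr_ge0.
exact: norm_term.
Qed.

Let norm_partial t N : `|series (term t) N| <= limn (series a).
Proof.
apply: (@le_trans _ _ (series a N)).
  rewrite /series/=; apply: (le_trans (ler_norm_sum _ _ _)).
  by apply: ler_sum => nu _; exact: norm_term.
apply: nondecreasing_cvgn_le => //.
by apply: nondecreasing_series => nu _ _; exact: a_ge0.
Qed.

Let bounded_measurable_partial N :
  bounded_measurable (fun t : R => series (term t) N).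
Proof.
split; last by exists (limn (series a)) => t; exact: norm_partial.
apply: measurable_sum => nu; apply: measurable_funM => //.
by case: (bounded_measurable_cos (measurable_mulr_const ((b ^ nu)%:R : R))).
Qed.

Lemma bounded_measurable_lacunary : bounded_measurable lacunary.
Proof.
split.
  apply: (measurable_fun_cvg (h := fun N t => series (term t) N)).
    by move=> N; case: (bounded_measurable_partial N).
  by move=> t _; exact: cvg_lacunary.
exists (limn (series a)) => t.
have /cvg_norm h := @cvg_lacunary t.
rewrite -(cvg_lim _ h)//; apply: limr_le.
  by apply/cvg_ex; eexists; exact: h.
by apply: nearW => N; exact: norm_partial.
Qed.

Lemma lacunary_periodic (t : R) (m : int) :
  lacunary (t + 2 * pi * m%:~R) = lacunary t.
Proof.
rewrite /lacunary; congr (limn (series _)); apply/funext => nu; congr (_ * _).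
rewrite mulrDr.
rewrite (_ : _ * (2 * pi * _) = ((b ^ nu)%N%:Z * m)%:~R * (2 * pi)); last first.
  by rewrite intrM; ring.
by rewrite cosD cos_int_2pi sin_int_2pi mulr1 mulr0 subr0.
Qed.

(** Dominated convergence: the partial sums are bounded by the sum of the
    [a nu]. *)
Lemma cvg_integral_lacunary (w : R -> R) : bounded_measurable w ->
  \sum_(0 <= nu < N) a nu * \int[unif]_t (cos ((b ^ nu)%:R * t) * w t)
    @[N --> \oo] --> \int[unif]_t (lacunary t * w t).
Proof.
move=> bw; have [mw [W wW]] := bw.
have bcw nu : bounded_measurable (fun t : R => cos ((b ^ nu)%:R * t) * w t).
  apply: bounded_measurableM => //.
  exact: (bounded_measurable_cos (measurable_mulr_const ((b ^ nu)%:R : R))).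
have bSw N : bounded_measurable (fun t : R => series (term t) N * w t).
  exact: bounded_measurableM.
have bFw := bounded_measurableM bounded_measurable_lacunary bw.
have SE N : \sum_(0 <= nu < N) a nu * \int[unif]_t (cos ((b ^ nu)%:R * t) * w t)
    = \int[unif]_t (series (term t) N * w t).
  elim: N => [|N IH].
    rewrite big_geq//; under eq_Rintegral do rewrite /series/= big_geq// mul0r.
    by rewrite Rintegral_probability_cst.
  rewrite big_nat_recr//= IH -RintegralZl//; last first.
    exact: (bounded_measurable_integrable unif (bcw N)).
  rewrite -RintegralD//; last 2 first.
  - exact: (bounded_measurable_integrable unif (bSw N)).
  - apply: (bounded_measurable_integrable unif).
    exact: bounded_measurableM (bounded_measurable_cst _) (bcw N).
  apply: eq_Rintegral => t _; rewrite /series/= big_nat_recr//= mulrDl.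
  by rewrite /term mulrA.
under eq_fun do rewrite SE.
pose fN N t := (series (term t) N * w t)%:E.
pose f t := (lacunary t * w t)%:E.
have mfN N : measurable_fun setT (fN N).
  by apply/measurable_EFinP; case: (bSw N).
have mf : measurable_fun setT f by apply/measurable_EFinP; case: bFw.
have fNf : {ae unif, forall t, setT t -> fN ^~ t @ \oo --> f t}.
  apply: aeW => t _; apply/cvg_EFin; first exact: nearW.
  by apply: cvgM; [exact: cvg_lacunary|exact: cvg_cst].
have ig : unif.-integrable setT (EFin \o cst (limn (series a) * W)).
  exact: (bounded_measurable_integrable unif (bounded_measurable_cst _)).
have fNg : {ae unif, forall t N, setT t ->
    (`|fN N t| <= (limn (series a) * W)%:E)%E}.
  apply: aeW => t N _; rewrite lee_fin normrM; exact: ler_pM.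
have [_ _] :=
  @dominated_convergence _ _ R unif setT measurableT fN f _ mfN mf fNf ig fNg.
move=> h; apply: fine_cvg.
rewrite fineK; first exact: h.
apply: integrable_fin_num => //.
exact: (bounded_measurable_integrable unif).
Qed.

Let uniform_coscos (p m : int) :
  \int[unif]_t (cos (p%:~R * t) * cos (m%:~R * t)) =
  ((p - m == 0)%:R + (p + m == 0)%:R) / 2.
Proof.
have bt (q : int) : bounded_measurable (fun t : R => cos (q%:~R * t)).
  exact: (bounded_measurable_cos (measurable_mulr_const (q%:~R : R))).
have iD :=
  bounded_measurable_integrable unif
    (bounded_measurableD (bt (p - m)) (bt (p + m))).
have ic q := bounded_measurable_integrable unif (bt q).
transitivity (\int[unif]_t (2^-1 *
    (cos ((p - m)%:~R * t) + cos ((p + m)%:~R * t)))).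
  apply: eq_Rintegral => t _.
  rewrite intrB intrD mulrBl mulrDl cosB cosD; field => //.
transitivity (2^-1 * (\int[unif]_t cos ((p - m)%:~R * t) +
    \int[unif]_t cos ((p + m)%:~R * t))).
  rewrite -(RintegralD measurableT (ic (p - m)) (ic (p + m))).
  exact: (RintegralZl _ measurableT iD).
by rewrite !uniform_cos mulrC.
Qed.

Let uniform_cossin (p m : int) :
  \int[unif]_t (cos (p%:~R * t) * sin (m%:~R * t)) = 0.
Proof.
have bt (q : int) : bounded_measurable (fun t : R => sin (q%:~R * t)).
  exact: (bounded_measurable_sin (measurable_mulr_const (q%:~R : R))).
have iD :=
  bounded_measurable_integrable unif
    (bounded_measurableD (bt (m + p)) (bt (m - p))).
have isn q := bounded_measurable_integrable unif (bt q).
transitivity (\int[unif]_t (2^-1 *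
    (sin ((m + p)%:~R * t) + sin ((m - p)%:~R * t)))).
  apply: eq_Rintegral => t _.
  rewrite intrB intrD mulrBl mulrDl sinB sinD; field => //.
transitivity (2^-1 * (\int[unif]_t sin ((m + p)%:~R * t) +
    \int[unif]_t sin ((m - p)%:~R * t))).
  rewrite -(RintegralD measurableT (isn (m + p)) (isn (m - p))).
  exact: (RintegralZl _ measurableT iD).
by rewrite !uniform_sin addr0 mulr0.
Qed.

Lemma integral_lacunary_sin (m : int) :
  \int[unif]_t (lacunary t * sin (m%:~R * t)) = 0.
Proof.
have /cvg_integral_lacunary :=
  bounded_measurable_sin (measurable_mulr_const (m%:~R : R)).
under eq_fun => N.
  rewrite big1; last first.
    by move=> nu _; have := uniform_cossin (b ^ nu)%N m => /= ->; rewrite mulr0.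
  over.
by move=> /cvg_lim <- //; exact: lim_cst.
Qed.

Let cos_term (nu : nat) (m : int) :
  \int[unif]_t (cos ((b ^ nu)%:R * t) * cos (m%:~R * t)) =
  (`|m| == b ^ nu)%N%:R / 2.
Proof.
have := uniform_coscos (b ^ nu)%N m => /= ->; congr (_ / _).
have : (0 < b ^ nu)%N by rewrite expn_gt0 (ltn_trans _ b_gt1).
rewrite subr_eq0 eq_sym addrC addr_eq0; move: (b ^ nu)%N => q q0.
by rewrite -natrD; congr (_%:R); case: m => j; lia.
Qed.

(** By lacunarity a single term of the series has frequency |m| = b^nu, whence
    the classical coefficient [a nu / 2]. *)
Lemma integral_lacunary_cos (nu : nat) (m : int) : `|m|%N = (b ^ nu)%N ->
  \int[unif]_t (lacunary t * cos (m%:~R * t)) = a nu / 2.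
Proof.
move=> mE; have /cvg_integral_lacunary h :=
  bounded_measurable_cos (measurable_mulr_const (m%:~R : R)).
have H : \sum_(0 <= mu < N)
    a mu * \int[unif]_t (cos ((b ^ mu)%:R * t) * cos (m%:~R * t))
    @[N --> \oo] --> a nu / 2.
  apply: (@cvg_near_cst) => //; exists nu.+1 => //= N /= nuN.
  rewrite (big_rem nu)/=; last by rewrite mem_index_iota.
  rewrite cos_term mE eqxx mul1r big_seq big1 ?addr0// => mu.
  rewrite mem_rem_uniq ?iota_uniq// !inE => /andP[munu _].
  by rewrite cos_term mE eqn_exp2l// eq_sym (negbTE munu) mul0r mulr0.
exact: (cvg_unique _ h H).
Qed.

Lemma integral_lacunary_cos_eq0 (m : int) : (forall nu, `|m|%N <> (b ^ nu)%N) ->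
  \int[unif]_t (lacunary t * cos (m%:~R * t)) = 0.
Proof.
move=> mE.
have /cvg_integral_lacunary :=
  bounded_measurable_cos (measurable_mulr_const (m%:~R : R)).
under eq_fun => N.
  rewrite big1; last first.
    move=> nu _; rewrite cos_term; case: eqP => [/mE//|_].
    by rewrite mul0r mulr0.
  over.
by move=> /cvg_lim <- //; exact: lim_cst.
Qed.

End lacunary_series.

(** * Maps depending on the first coordinate *)

Section first_coordinate.
Context {R : realType}.
Local Notation unif := (uniform_prob (@two_pi_gt0 R)).

(** All components are taken equal, so that the squared Hermitian norm of a
    Fourier coefficient is [n.+1] times that of one component. *)
Definition first_coordinate_map n (F : R -> R) (x : n.+1.-tuple R) :
  n.+1.-tuple R := [tuple F (tnth x ord0) | j < n.+1].

Let tnth_first_coordinate n (F : R -> R) (x : n.+1.-tuple R) j :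
  tnth (first_coordinate_map F x) j = F (tnth x ord0).
Proof. by rewrite tnth_mktuple. Qed.

Lemma torus_map_first_coordinate n (F : R -> R) : bounded_measurable F ->
  (forall (t : R) (m : int), F (t + 2 * pi * m%:~R) = F t) ->
  torus_map (@first_coordinate_map n F).
Proof.
move=> bF perF; split=> [x m|j].
  apply: eq_from_tnth => j; rewrite !tnth_mktuple; exact: perF.
rewrite (_ : (fun x => _) = (fun x => F (tnth x ord0))); last first.
  by apply/funext => x; rewrite tnth_first_coordinate.
apply: bounded_measurable_Lfun.
exact: (bounded_measurable_comp (measurable_tnth _) bF).
Qed.

Lemma cnorm_fourier_coef_first_coordinate n (F : R -> R) k0 (k : n.-tuple int) :
  bounded_measurable F ->
  \int[unif]_t (F t * sin (k0%:~R * t)) = 0 ->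
  cnorm (fourier_coef (first_coordinate_map F) [tuple of k0 :: k]) ^+ 2 =
  n.+1%:R *
  ((norm1 k == 0%N)%:R * \int[unif]_t (F t * cos (k0%:~R * t))) ^+ 2 :> R.
Proof.
move=> bF s0; have [hc hs] := haar_tensor k0 k bF.
rewrite s0 mulr0 in hs.
rewrite /cnorm sqr_sqrtr; last by apply: sumr_ge0 => j _; exact: sqr_ge0.
rewrite (eq_bigr (fun=> ((norm1 k == 0%N)%:R *
    \int[unif]_t (F t * cos (k0%:~R * t))) ^+ 2)).
  by rewrite sumr_const card_ord [RHS]mulr_natl.
move=> j _; rewrite mxE /cintegral.
rewrite (@eq_Rintegral _ _ _ _ _
  (fun x => F (tnth x ord0) * cos (dotk [tuple of k0 :: k] x))); last first.
  by move=> x _; rewrite /= tnth_first_coordinate cosN mul0r subr0.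
rewrite [X in Complex _ X](@eq_Rintegral _ _ _ _ _
  (fun x => - 1 *
    (F (tnth x ord0) * sin (dotk [tuple of k0 :: k] x)))); last first.
  by move=> x _; rewrite /= tnth_first_coordinate sinN mul0r addr0 mulrN mulN1r.
rewrite hc RintegralZl//; last first.
  apply: (bounded_measurable_integrable (haar n.+1)).
  apply: bounded_measurableM.
    exact: (bounded_measurable_comp (measurable_tnth _) bF).
  exact: (bounded_measurable_sin (@measurable_dotk _ _ _)).
rewrite hs mulr0 /ComplexField.Normc.normc expr0n/= addr0.
by rewrite sqrtr_sqr real_normK// num_real.
Qed.

End first_coordinate.

(** * Shells of frequencies *)

Section shells.
Context {R : realType}.
Variables (n b : nat).
Hypothesis b_gt1 : (1 < b)%N.

(** Multiplying the lower bound by [b] removes the exponent nu - 1, which is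
    negative for nu = 0. *)
Lemma shellE nu (k : n.-tuple int) :
  @shell R n b nu k <-> (b ^ nu < b * norm1 k)%N /\ (norm1 k <= b ^ nu)%N.
Proof.
have b0 : 0 < b%:R :> R by rewrite ltr0n (ltn_trans _ b_gt1).
rewrite /shell/= expfzDr ?gt_eqF// exprN1 ltr_pdivrMr//.
by rewrite -exprnP -!natrX -natrM ltr_nat ler_nat mulnC.
Qed.

Arguments shellE : clear implicits.
Lemma norm1_shell nu (k : n.-tuple int) : @shell R n b nu k -> (0 < norm1 k)%N.
Proof.
move=> h; have [+ _] := (shellE _ _).1 h.
by case: norm1 => //; rewrite muln0.
Qed.

Lemma trivIset_shell : trivIset setT (@shell R n b).
Proof.
have H mu nu k :
    (mu < nu)%N -> @shell R n b mu k -> @shell R n b nu k -> False.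
  move=> munu h1 h2; have [_ kmu] := (shellE _ _).1 h1.
  have [nuk _] := (shellE _ _).1 h2.
  have := leq_pexp2l (ltnW b_gt1) munu.
  by rewrite leqNgt (leq_trans nuk)// expnS leq_mul2l kmu orbT.
move=> mu nu _ _ [k [kmu knu]].
by have [/H/(_ kmu knu)|/H/(_ knu kmu)|//] := ltngtP mu nu.
Qed.

Lemma bigcup_shell : \bigcup_nu (@shell R n b nu) = [set k | (0 < norm1 k)%N].
Proof.
apply/seteqP; split=> [k [nu _]|k /= k0]; first exact: norm1_shell.
have ex : exists nu, (norm1 k <= b ^ nu)%N.
  by exists (norm1 k); exact/ltnW/ltn_expl.
exists (ex_minn ex) => //; apply: (shellE _ _).2.
case: ex_minnP => -[|nu] kle kmin; split => //.
  by rewrite expn0 (leq_trans b_gt1)// leq_pmulr.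
rewrite expnS ltn_pmul2l ?(ltn_trans _ b_gt1)// ltnNge; apply/negP => /kmin.
by rewrite ltnn.
Qed.

(** The zero frequency lies in no shell, hence the condition on [g]. *)
Lemma esum_shell (g : n.-tuple int -> \bar R) :
    (forall k, (0 <= g k)%E) ->
  (forall k, norm1 k = 0%N -> g k = 0%E) ->
  (\esum_(k in [set: n.-tuple int]) g k =
   \sum_(0 <= nu <oo) \esum_(k in @shell R n b nu) g k)%E.
Proof.
move=> g0 gz; rewrite -nneseries_sum_bigcup//; last exact: trivIset_shell.
rewrite bigcup_shell [RHS]esum_mkcond; apply: eq_esum => k _.
case: ifPn => //; rewrite notin_setE/= => /negP.
by rewrite -eqn0Ngt => /eqP/gz.
Qed.

End shells.

(** * Comparison of sums of nonnegative families *)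

Section esum_lemmas.
Context {R : realType} {T : choiceType}.

Lemma esum_le_mul (A : set T) (g h : T -> \bar R) (r : R) : 0 <= r ->
  (forall x, A x -> 0 <= h x)%E ->
  (forall x, A x -> g x <= r%:E * h x)%E ->
  (\esum_(x in A) g x <= r%:E * \esum_(x in A) h x)%E.
Proof.
move=> r0 h0 gh; apply: ge_ereal_sup => _ [X [finX XA]] <-.
apply: (@le_trans _ _ (\sum_(x \in X) r%:E * h x)%E).
  by apply: lee_fsum => // x /XA; exact: gh.
rewrite fsbig_finite//= big_seq -ge0_sume_distrr; last first.
  by move=> x; rewrite in_fset_set// inE => /XA; exact: h0.
rewrite -big_seq lee_wpmul2l ?lee_fin// -fsbig_finite//.
by apply: ereal_sup_ubound; exists X.
Qed.

Lemma esum_le_pair (A : set T) (g : T -> \bar R) (p q : T) (v : \bar R) :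
  (0 <= v)%E -> (forall x, A x -> g x <= v)%E ->
  (forall x, A x -> x <> p -> x <> q -> g x = 0%E) ->
  (\esum_(x in A) g x <= v + v)%E.
Proof.
move=> v0 gv gz.
have E (y : T) : (\esum_(x in A) (if x == y then v else 0) <= v)%E.
  rewrite esum_mkcond.
  rewrite -[leRHS](@esum_set1 _ _ y (fun=> v))// [leRHS]esum_mkcond.
  apply: le_esum => x _; rewrite in_set1.
  by case: (x == y); case: (x \in A).
apply: le_trans (leeD (E p) (E q)); rewrite -esumD.
- apply: le_esum => x Ax.
  have [xpE|/eqP xp] := eqVneq x p.
    apply: (le_trans (gv _ Ax)).
    by rewrite leeDl//; case: ifP.
  have [xq|/eqP xq] := eqVneq x q; first by rewrite add0e gv.
  by rewrite gz// adde0.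
- by move=> x _; case: ifP.
- by move=> x _; case: ifP.
Qed.

End esum_lemmas.

(** * Numerical series *)

Section numerical_series.
Context {R : realType}.

Lemma nneseries_le_bound (u : R^nat) (M : R) : (forall i, 0 <= u i) ->
  (forall N, \sum_(0 <= i < N) u i <= M) ->
  (\sum_(0 <= i <oo) (u i)%:E <= M%:E)%E.
Proof.
move=> u0 uM; apply: lime_le.
  by apply: is_cvg_nneseries => i _ _; rewrite lee_fin.
by apply: nearW => N; rewrite sumEFin lee_fin.
Qed.

(** With s = alpha - 1, convexity in the form e^x >= 1 + x gives
    s (i + 1)^(-alpha) <= i^(-s) - (i + 1)^(-s), and the right-hand side
    telescopes. *)
Lemma riemannR_summable (alpha : R) : 1 < alpha ->
  (\sum_(0 <= i <oo) (riemannR alpha i)%:E < +oo)%E.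
Proof.
move=> a1; have [s sE] : {s | s = alpha - 1} by exists (alpha - 1).
have s0 : 0 < s by rewrite sE subr_gt0.
have r0 i : 0 <= riemannR alpha i by apply/ltW/riemannR_gt0; lra.
suff H N : \sum_(0 <= i < N.+1) riemannR alpha i
    <= 1 + s^-1 * (1 - (N.+1%:R `^ s)^-1).
  apply: le_lt_trans (ltry (1 + s^-1)); apply: nneseries_le_bound => // -[|N].
    by rewrite big_geq// addr_ge0// invr_ge0 ltW.
  apply: (le_trans (H N)); rewrite lerD2l ler_piMr// ?invr_ge0 ?(ltW s0)//.
elim: N => [|N IH].
  by rewrite big_nat1 /riemannR !powR1 invr1 subrr mulr0 addr0.
rewrite big_nat_recr//=; apply: (le_trans (lerD IH (lexx _))).
rewrite -addrA lerD2l /riemannR.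
set x : R := N.+1%:R; set y : R := N.+2%:R.
have x0 : 0 < x by rewrite ltr0n.
have y0 : 0 < y by rewrite ltr0n.
have yx : y = x + 1 by rewrite /y /x -natr1.
clearbody x y.
have ys0 : 0 < y `^ s by exact: powR_gt0.
have -> : y `^ alpha = y * y `^ s.
  by rewrite sE mulr_powRB1// ?ltW// (lt_trans ltr01).
rewrite -lerBrDl -mulrBr ler_pdivlMl//.
rewrite (_ : 1 - _ - _ = (x `^ s)^-1 - (y `^ s)^-1); last by ring.
rewrite invfM mulrA ler_pdivrMr// mulrBl mulVf ?gt_eqF//.
have -> : (x `^ s)^-1 * y `^ s = (y / x) `^ s.
  rewrite powRM ?invr_ge0 ?ltW// mulrC; congr (_ * _).
  by rewrite -[in RHS]powR_inv1 ?ltW// -powRrM mulN1r powRN.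
have yx0 : y / x != 0 by rewrite gt_eqF// divr_gt0.
rewrite lerBrDl /powR (negbTE yx0).
apply: le_trans (expR_ge1Dx _); rewrite lerD2l ler_pM2l//.
have := @le_ln1Dx R (x / y - 1).
rewrite [1 + _]addrC subrK (_ : x / y = (y / x)^-1); last by rewrite invf_div.
rewrite lnV ?posrE ?divr_gt0// lerNl invf_div.
have xy0 : 0 < x / y by exact: divr_gt0.
move=> h; apply: le_trans (h _); last by lra.
have -> : x = y - 1 by rewrite yx addrK.
by rewrite mulrBl divff ?gt_eqF// mul1r; lra.
Qed.

Let D (N : nat) : R := 1 + series harmonic N.

(** The quotient (D_(nu+1) - D_nu) / D_nu for the divergent sums
    D_nu = 1 + H_nu of the harmonic series. By Abel and Dini these quotients
    still have a divergent sum, whereas a further factor 1 / D_(nu+1) makes the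
    sum converge. *)
Definition abel_dini (nu : nat) : R := (nu.+1%:R * (1 + series harmonic nu))^-1.

Let D_ge1 N : 1 <= D N.
Proof. by rewrite lerDl; apply: sumr_ge0 => i _; exact: harmonic_ge0. Qed.

Let D_gt0 N : 0 < D N.
Proof. exact: lt_le_trans (D_ge1 N). Qed.

Let DS N : D N.+1 = D N + N.+1%:R^-1.
Proof. by rewrite /D /series/= big_nat_recr//= addrA. Qed.

Lemma abel_dini_gt0 nu : 0 < abel_dini nu.
Proof. by rewrite invr_gt0 mulr_gt0//; exact: D_gt0. Qed.

Lemma abel_dini_le1 nu : abel_dini nu <= 1.
Proof.
rewrite invf_le1; last by rewrite mulr_gt0//; exact: D_gt0.
by rewrite -[leLHS]mulr1 ler_pM// ?ler1n//; exact: D_ge1.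
Qed.

(** The partial sums dominate ln D_N, since
    ln D_(nu+1) - ln D_nu = ln (1 + c_nu) <= c_nu. *)
Lemma abel_dini_dvg (M : R) :
  ~ (forall N, \sum_(0 <= nu < N) abel_dini nu <= M).
Proof.
move=> H.
have lnD N : ln (D N) <= \sum_(0 <= nu < N) abel_dini nu.
  elim: N => [|N IH]; first by rewrite /D /series/= !big_geq// addr0 ln1.
  rewrite big_nat_recr//=.
  have -> : D N.+1 = D N * (1 + abel_dini N).
    rewrite DS mulrDr mulr1 /abel_dini invfM -/(D N) mulrCA mulfV ?mulr1//.
    by rewrite gt_eqF.
  have c0 := abel_dini_gt0 N.
  rewrite lnM ?posrE ?D_gt0 ?(addr_gt0 ltr01 c0)//; apply: lerD => //.
  by apply: le_ln1Dx; rewrite (lt_trans _ c0).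
have hM N : series harmonic N <= expR M.
  rewrite (@le_trans _ _ (D N))//; first by rewrite lerDr.
  rewrite -[leLHS]lnK ?posrE// ler_expR.
  exact: le_trans (lnD N) (H N).
apply: (@dvg_harmonic R); apply: nondecreasing_is_cvgn.
  by apply: nondecreasing_series => i _ _; exact: harmonic_ge0.
by exists (expR M) => _ [N _ <-].
Qed.

(** The general term is at most 2 (1 / D_nu - 1 / D_(nu+1)), because
    D_(nu+1) <= 2 D_nu. *)
Lemma abel_dini_sqr_le2 N :
  \sum_(0 <= nu < N) abel_dini nu ^+ 2 * nu.+1%:R <= 2.
Proof.
suff H : \sum_(0 <= nu < N) abel_dini nu ^+ 2 * nu.+1%:R <= 2 * (1 - (D N)^-1).
  apply: (le_trans H); rewrite -[leRHS]mulr1 ler_pM2l// gerBl invr_ge0.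
  exact: ltW.
elim: N => [|N IH].
  by rewrite /D /series/= !big_geq// addr0 invr1 subrr mulr0.
rewrite big_nat_recr//=; apply: (le_trans (lerD IH (lexx _))).
rewrite /abel_dini -/(D N) DS.
have n0 : 0 < N.+1%:R :> R by rewrite ltr0n.
have n1 : 1 <= N.+1%:R :> R by rewrite ler1n.
move: (D N) (D_ge1 N) => d d1; move: (N.+1%:R : R) n0 n1 => m m0 m1.
have d0 : 0 < d by exact: lt_le_trans d1.
have md0 : 0 < m * d + 1 by rewrite addr_gt0// mulr_gt0.
have -> : (d + m^-1)^-1 = m / (m * d + 1).
  by field; rewrite !gt_eqF//= addr_gt0// invr_gt0.
rewrite -subr_ge0.
have -> : 2 * (1 - m / (m * d + 1)) - (2 * (1 - d^-1) + (m * d)^-1 ^+ 2 * m) =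
  (m * d - 1) / (m * d ^+ 2 * (m * d + 1)).
  by field; rewrite !gt_eqF.
apply: divr_ge0; last first.
  by apply: mulr_ge0 (ltW md0); apply: mulr_ge0 (ltW m0) (sqr_ge0 _).
by rewrite subr_ge0 -[leLHS]mulr1 ler_pM.
Qed.

(** By the arithmetic-geometric mean inequality applied to w S and 1 / w; [S]
    may be infinite, as a sum over a shell a priori may. *)
Lemma poweR_half_le (S : \bar R) (w : R) : (0 <= S)%E -> 0 < w ->
  (S `^ 2^-1 <= w%:E * S + (w^-1)%:E)%E.
Proof.
move=> S0 w0; case: S S0 => [s| |]//; rewrite ?lee_fin => s0; last first.
  by rewrite gt0_muley ?lte_fin// addye// leey.
rewrite powR12_sqrt// -[leLHS]ger0_norm ?sqrtr_ge0// -sqrtr_sqr.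
have t0 : 0 <= w * s + w^-1.
  by apply: addr_ge0; [exact: mulr_ge0 (ltW w0) s0|rewrite invr_ge0 ltW].
rewrite sqr_sqrtr//.
have -> : w * s + w^-1 = Num.sqrt ((w * s + w^-1) ^+ 2).
  by rewrite sqrtr_sqr ger0_norm.
rewrite ler_sqrt; last exact: sqr_ge0.
have -> : (w * s + w^-1) ^+ 2 = s + s + (w * s) ^+ 2 + w^-1 ^+ 2.
  by field; rewrite gt_eqF.
by rewrite -!addrA lerDl !addr_ge0 ?sqr_ge0.
Qed.

End numerical_series.

(** * The inclusion for alpha > 1 *)

Section inclusion.
Context {R : realType}.
Variables (n b : nat).
Hypotheses (hb : (1 < b)%N).

(** For nu > 0, |k| > b^(nu-1) >= 2^(nu-1) and |k| >= 1 give
    (1 + |k|)^3 >= (1 + |k|) 2^2 >= 2^(nu+1). The cube absorbs the shift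
    from nu - 1 to nu + 1. *)
Lemma ln_shell_ge nu (k : n.-tuple int) : @shell R n b nu k ->
  ln 2 / 3 * nu.+1%:R <= ln (1 + (norm1 k)%:R) :> R.
Proof.
move=> knu; have k0 := norm1_shell hb knu.
have [blt _] := (shellE hb nu k).1 knu.
have H : (2 ^ nu.+1 <= (1 + norm1 k) ^ 3)%N.
  apply: (@leq_trans ((1 + norm1 k) * 2 ^ 2)); last first.
    by rewrite (expnS _ 2) leq_mul2l leq_exp2r.
  case: nu {knu} blt => [_|nu blt]; first by rewrite expn1; lia.
  have : (b ^ nu < norm1 k)%N by move: blt; rewrite expnS ltn_pmul2l// ltnW.
  have : (2 ^ nu <= b ^ nu)%N by case: (nu) => // m; rewrite leq_exp2r.
  rewrite 2!expnS; lia.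
rewrite mulrAC ler_pdivrMr// mulr_natr [leRHS]mulr_natr.
have N0 : 0 < 1 + (norm1 k)%:R :> R by rewrite addr_gt0// ltr0n.
rewrite -!lnXn// ler_ln ?posrE ?exprn_gt0//.
by rewrite -(natrD _ 1) -!natrX ler_nat.
Qed.

Lemma Hlog_sub_L2tilde (tau alpha : R) :
  1 < alpha -> @Hlog R n tau alpha `<=` L2tilde n b tau.
Proof.
move=> a1 f [tf Hf]; split=> //.
pose g k := (cnorm (fourier_coef f k) ^+ 2 * (norm1 k)%:R `^ (2 * tau + 2))%:E.
pose h k := (cnorm (fourier_coef f k) ^+ 2 * (norm1 k)%:R `^ (2 * tau + 2) *
  ln (1 + (norm1 k)%:R) `^ alpha)%:E.
have g0 k : (0 <= g k)%E by rewrite lee_fin mulr_ge0 ?sqr_ge0 ?powR_ge0.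
have h0 k : (0 <= h k)%E.
  by rewrite lee_fin mulr_ge0 ?powR_ge0// mulr_ge0 ?sqr_ge0 ?powR_ge0.
have a0 : 0 <= alpha by lra.
pose c : R := (ln 2 / 3) `^ alpha.
have l0 : 0 < ln 2 / 3 :> R by rewrite divr_gt0// ln_gt0// ltr1n.
have c0 : 0 < c by exact: powR_gt0.
pose w nu : R := nu.+1%:R `^ alpha.
have w0 nu : 0 < w nu by rewrite powR_gt0.
pose T nu := (\esum_(k in @shell R n b nu) h k)%E.
have T0 nu : (0 <= T nu)%E by exact: esum_ge0.
have Tfin : (\sum_(0 <= nu <oo) T nu < +oo)%E.
  rewrite -esum_shell//; first by apply: lty_poweRy Hf; rewrite invr_eq0.
  move=> k k0; rewrite /h k0 addr0 ln1 powR0 ?mulr0//.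
  by rewrite gt_eqF//; lra.
have ST nu : (\esum_(k in @shell R n b nu) g k <= (c * w nu)^-1%:E * T nu)%E.
  apply: esum_le_mul => //; first by rewrite invr_ge0 mulr_ge0// ltW.
  move=> k knu; rewrite -EFinM lee_fin ler_pdivlMl ?mulr_gt0//.
  rewrite [leLHS]mulrC; apply: ler_wpM2l; first by rewrite -lee_fin; exact: g0.
  rewrite /c /w -powRM ?(ltW l0)//.
  apply: ge0_ler_powR => //.
  - by rewrite nnegrE mulr_ge0// ltW.
  - by rewrite nnegrE ln_ge0// lerDl.
  - exact: ln_shell_ge.
apply: (@le_lt_trans _ _
  (\sum_(0 <= nu <oo) ((c^-1)%:E * T nu + (riemannR alpha nu)%:E))%E).
  apply: lee_nneseries => [nu _ _|nu _]; first exact: poweR_ge0.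
  apply: (le_trans (poweR_half_le (esum_ge0 (fun k _ => g0 k)) (w0 nu))).
  apply: leeD => //.
  apply: (@le_trans _ _ ((w nu)%:E * ((c * w nu)^-1%:E * T nu))%E).
    by apply: lee_wpmul2l (ST nu); rewrite lee_fin ltW.
  by rewrite muleA -EFinM invfM mulrCA mulfV ?mulr1// gt_eqF.
rewrite nneseriesD; last 2 first.
- by move=> nu _ _; rewrite mule_ge0// lee_fin invr_ge0 ltW.
- by move=> nu _ _; rewrite lee_fin ltW// riemannR_gt0.
rewrite nneseriesZl// lte_add_pinfty//; last exact: riemannR_summable.
by rewrite lte_mul_pinfty// lee_fin invr_ge0 ltW.
Qed.

End inclusion.

(** * The counterexample for alpha <= 1 *)

Section counterexample.
Context {R : realType}.
Local Notation unif := (uniform_prob (@two_pi_gt0 R)).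
Variables (n b : nat) (tau alpha : R).
Hypotheses (hb : (1 < b)%N) (tau_ge0 : 0 <= tau).

Let bnu_gt0 nu : 0 < (b ^ nu)%:R :> R.
Proof. by rewrite ltr0n expn_gt0 (ltn_trans _ hb). Qed.

Let bnu_ge1 nu : 1 <= (b ^ nu)%:R :> R.
Proof. by rewrite ler1n expn_gt0 (ltn_trans _ hb). Qed.

Let coef nu : R := abel_dini nu * (b ^ nu)%:R `^ (- (tau + 1)).

Let coef_ge0 nu : 0 <= coef nu.
Proof. by rewrite mulr_ge0 ?powR_ge0// ltW// abel_dini_gt0. Qed.

Let cvg_coef : cvgn (series coef).
Proof.
have h2 : `|2^-1 : R| < 1 by rewrite ger0_norm; lra.
apply: series_le_cvg (is_cvg_geometric_series (a := 1) h2) => [//|nu|nu].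
  by rewrite /geometric/= mul1r exprn_ge0// invr_ge0.
rewrite /geometric/= mul1r -[leRHS]mul1r; apply: ler_pM (abel_dini_le1 nu) _.
- by rewrite ltW// abel_dini_gt0.
- exact: powR_ge0.
rewrite powRN exprVn lef_pV2 ?posrE ?exprn_gt0 ?powR_gt0//.
apply: (@le_trans _ _ ((b ^ nu)%:R `^ 1)); last by rewrite ler_powR// lerDr.
rewrite powRr1; last exact: ltW.
by rewrite natrX lerXn2r ?nnegrE ?ler0n// ler_nat.
Qed.

(** The factor (b^nu)^(-(tau + 1)) cancels the weight |k|^(2 tau + 2) at
    |k| = b^nu, leaving the Abel-Dini numbers. *)
Definition lacunary_map : n.+1.-tuple R -> n.+1.-tuple R :=
  first_coordinate_map (lacunary b coef).

Lemma torus_map_lacunary_map : torus_map lacunary_map.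
Proof.
apply: torus_map_first_coordinate; first exact: bounded_measurable_lacunary.
by move=> t m; exact: lacunary_periodic.
Qed.

Let axis (m : int) : n.+1.-tuple int := [tuple of m :: nseq_tuple n 0].

Let norm1_zeros : norm1 (nseq_tuple n (0 : int)) = 0%N.
Proof.
by rewrite /norm1 big1// => j _; rewrite (tnth_nth 0) nth_nseq if_same.
Qed.

Let norm1_eq0 (k : n.-tuple int) : norm1 k = 0%N -> k = nseq_tuple n 0.
Proof.
move=> /eqP; rewrite /norm1 sum_nat_eq0 => /forallP k0.
apply: eq_from_tnth => j; have /= := k0 j.
by rewrite absz_eq0 => /eqP ->; rewrite (tnth_nth 0) nth_nseq if_same.
Qed.

Let weight (k : n.+1.-tuple int) : R :=
  cnorm (fourier_coef lacunary_map k) ^+ 2 * (norm1 k)%:R `^ (2 * tau + 2).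

Let weightE k0 (k : n.-tuple int) : weight [tuple of k0 :: k] =
  n.+1%:R * ((norm1 k == 0%N)%:R *
    \int[unif]_t (lacunary b coef t * cos (k0%:~R * t))) ^+ 2
  * (norm1 [tuple of k0 :: k])%:R `^ (2 * tau + 2).
Proof.
rewrite /weight cnorm_fourier_coef_first_coordinate//.
  exact: bounded_measurable_lacunary.
exact: integral_lacunary_sin.
Qed.

Let weight_axis nu (m : int) : `|m|%N = (b ^ nu)%N ->
  weight (axis m) = n.+1%:R * abel_dini nu ^+ 2 / 4.
Proof.
move=> mE; rewrite /axis weightE norm1_cons norm1_zeros addn0 mE.
rewrite (integral_lacunary_cos hb coef_ge0 cvg_coef mE) mul1r /coef.
have -> : 2 * tau + 2 = (tau + 1) + (tau + 1) by ring.
rewrite powRD; last by rewrite (gt_eqF (bnu_gt0 _)) implybT.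
rewrite powRN; have : (b ^ nu)%:R `^ (tau + 1) != 0 :> R.
  by rewrite gt_eqF// powR_gt0.
move: (_ `^ _) => x x0; field; exact: x0.
Qed.

Let weight_shell nu k : @shell R n.+1 b nu k ->
  k <> axis (b ^ nu)%N -> k <> axis (- (b ^ nu)%N%:Z) -> weight k = 0.
Proof.
case/tupleP: k => k0 k knu kp kq; rewrite weightE.
have [kz|] := eqVneq (norm1 k) 0%N; last first.
  by rewrite mul0r expr0n mulr0 mul0r.
rewrite mul1r; have [[mu kmu]|nmu] := pselect (exists mu, `|k0|%N = (b ^ mu)%N).
  exfalso.
  have [lo up] := (shellE hb nu _).1 knu.
  move: lo up; rewrite norm1_cons kz addn0 kmu -expnS.
  rewrite ltn_exp2l// leq_exp2l// ltnS => numu munu.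
  have numuE : nu = mu by apply/eqP; rewrite eqn_leq numu munu.
  rewrite -numuE in kmu.
  case: k0 kmu kp kq {knu} => m /= kmu kp kq.
    by apply: kp; rewrite (norm1_eq0 kz) /axis kmu.
  by apply: kq; rewrite (norm1_eq0 kz) /axis -kmu NegzE.
rewrite integral_lacunary_cos_eq0//; first by rewrite expr0n mulr0 mul0r.
by move=> mu kmu; apply: nmu; exists mu.
Qed.

Let shell_axis nu : @shell R n.+1 b nu (axis (b ^ nu)%N).
Proof.
apply: (shellE hb nu _).2.
rewrite norm1_cons norm1_zeros addn0 /= leqnn; split => //.
by rewrite -expnS ltn_exp2l.
Qed.

Let weight_ge0 k : 0 <= weight k.
Proof. by rewrite mulr_ge0 ?sqr_ge0 ?powR_ge0. Qed.

(** One frequency already gives each shell a sum of at least (c_nu / 2)^2. *)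
Lemma lacunary_map_notin_L2tilde : ~ L2tilde n.+1 b tau lacunary_map.
Proof.
move=> [_ fin].
pose S nu := (\esum_(k in @shell R n.+1 b nu) (weight k)%:E)%E.
have S0 nu : (0 <= S nu)%E by apply: esum_ge0 => k _; rewrite lee_fin.
have SE nu : ((abel_dini nu / 2)%:E <= S nu `^ 2^-1)%E.
  have ad0 : 0 <= abel_dini nu :> R by rewrite ltW// abel_dini_gt0.
  rewrite -[leLHS]gee0_abs ?lee_fin ?divr_ge0//.
  have -> : `|(abel_dini nu / 2)%:E|%E =
      (((abel_dini nu / 2) ^+ 2)%:E `^ 2^-1)%E :> \bar R.
    by rewrite poweR_EFin powR12_sqrt ?sqr_ge0// sqrtr_sqr.
  apply: gt0_ler_poweR.
  - by rewrite invr_ge0.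
  - by rewrite in_itv/= lee_fin sqr_ge0 leey.
  - by rewrite in_itv/= S0 leey.
  apply: (@le_trans _ _ (weight (axis (b ^ nu)%N))%:E).
    rewrite lee_fin (@weight_axis nu)// expr_div_n.
    have : 1 <= n.+1%:R :> R by rewrite ler1n.
    by move: (sqr_ge0 (abel_dini nu : R)); nra.
  apply: esum_ge; exists [set axis (b ^ nu)%N]; last by rewrite fsbig_set1.
  by split; [exact: finite_set1|move=> _ ->; exact: shell_axis].
have : (\sum_(0 <= nu <oo) (abel_dini nu / 2)%:E < +oo :> \bar R)%E.
  apply: le_lt_trans fin; apply: lee_nneseries => // nu _ _.
  by rewrite lee_fin divr_ge0// ltW// abel_dini_gt0.
set X := (\sum_(0 <= nu <oo) _)%E => Xfin.
have X0 : (0 <= X)%E.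
  apply: nneseries_ge0 => nu _ _.
  by rewrite lee_fin divr_ge0// ltW// abel_dini_gt0.
apply: (@abel_dini_dvg R (2 * fine X)) => N.
rewrite -ler_pdivrMl// mulrC mulr_suml -lee_fin.
rewrite fineK; last by rewrite ge0_fin_numE.
rewrite -sumEFin; apply: nneseries_lim_ge => nu _ _.
by rewrite lee_fin divr_ge0// ltW// abel_dini_gt0.
Qed.

(** On |k| = b^nu the logarithm is at most (nu + 1) ln b, and
    (nu + 1)^alpha <= nu + 1 because alpha <= 1. *)
Lemma lacunary_map_in_Hlog : 0 < alpha <= 1 -> Hlog n.+1 tau alpha lacunary_map.
Proof.
move=> /andP[al0 al1]; split; first exact: torus_map_lacunary_map.
apply: poweR_lty.
pose h (k : n.+1.-tuple int) := (weight k * ln (1 + (norm1 k)%:R) `^ alpha)%:E.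
have h0 k : (0 <= h k)%E by rewrite lee_fin mulr_ge0// powR_ge0.
rewrite (esum_shell hb (g := h))//; last first.
  by move=> k k0; rewrite /h k0 addr0 ln1 powR0 ?mulr0// gt_eqF.
have lb0 : 0 <= ln b%:R :> R by rewrite ln_ge0// ler1n ltnW.
pose K : R := n.+1%:R / 4 * ln b%:R `^ alpha.
have K0 : 0 <= K by rewrite mulr_ge0 ?powR_ge0// divr_ge0.
pose v nu : R := K * (abel_dini nu ^+ 2 * nu.+1%:R).
have v0 nu : 0 <= v nu by rewrite mulr_ge0// mulr_ge0// sqr_ge0.
have hv nu m : `|m|%N = (b ^ nu)%N -> (h (axis m) <= (v nu)%:E)%E.
  move=> mE; rewrite lee_fin (weight_axis mE) norm1_cons norm1_zeros addn0 mE.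
  pose q : R := n.+1%:R / 4 * abel_dini nu ^+ 2.
  have q0 : 0 <= q by apply: mulr_ge0; [rewrite divr_ge0|exact: sqr_ge0].
  rewrite [leLHS](_ : _ = q * ln (1 + (b ^ nu)%:R) `^ alpha); last first.
    by rewrite /q; ring.
  rewrite [leRHS](_ : _ = q * (ln b%:R `^ alpha * nu.+1%:R)); last first.
    by rewrite /v /K /q; ring.
  apply: ler_wpM2l => //.
  apply: (@le_trans _ _ ((ln b%:R * nu.+1%:R) `^ alpha)).
    apply: ge0_ler_powR; rewrite ?nnegrE ?ln_ge0 ?lerDl ?mulr_ge0 ?(ltW al0)//.
    rewrite mulr_natr -lnXn ?ltr0n ?(ltn_trans _ hb)//.
    rewrite ler_ln ?posrE ?addr_gt0//; last first.
      by rewrite exprn_gt0// ltr0n (ltn_trans _ hb).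
    rewrite -natrX expnS -(natrD _ 1) ler_nat.
    have : (0 < b ^ nu)%N by rewrite expn_gt0 (ltn_trans _ hb).
    by move: hb; nia.
  rewrite powRM// ler_wpM2l ?powR_ge0//.
  by apply: ler1_powR => //; rewrite ler1n.
apply: (@le_lt_trans _ _ (\sum_(0 <= nu <oo) (v nu + v nu)%:E)%E).
  apply: lee_nneseries => nu _; first by move=> _; exact: esum_ge0.
  rewrite EFinD.
  apply: (@esum_le_pair _ _ _ _ (axis (b ^ nu)%N) (axis (- (b ^ nu)%N%:Z))).
  - by rewrite lee_fin.
  - move=> k knu.
    have [->|/eqP kp] := eqVneq k (axis (b ^ nu)%N); first exact: hv.
    have [->|/eqP kq] := eqVneq k (axis (- (b ^ nu)%N%:Z)).
      by apply: hv; rewrite abszN.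
    by rewrite /h (weight_shell knu)// mul0r lee_fin.
  - by move=> k knu kp kq; rewrite /h (weight_shell knu)// mul0r.
apply: le_lt_trans (ltry (K * 2 + K * 2)); apply: nneseries_le_bound => [nu|N].
  by rewrite addr_ge0.
rewrite big_split/= -mulr_sumr.
by apply: lerD; rewrite ler_wpM2l// abel_dini_sqr_le2.
Qed.

End counterexample.

Theorem theorem1p2 (R : realType) (n b : nat) (tau alpha : R)
    (hn : (2 <= n)%N) (hb : (2 <= b)%N) (htau : n%:R - 1 <= tau)
    (halpha : 0 < alpha) :
  Hlog n tau alpha `<=` L2tilde n b tau <-> 1 < alpha.
Proof.
split=> [sub|]; last exact: Hlog_sub_L2tilde.
rewrite ltNge; apply/negP => alpha_le1.
case: n hn htau sub => // n' hn htau sub.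
have tau_ge0 : 0 <= tau.
  by apply: le_trans htau; rewrite subr_ge0 ler1n.
apply: (@lacunary_map_notin_L2tilde R n' b tau hb tau_ge0).
by apply: sub; apply: lacunary_map_in_Hlog => //; rewrite halpha.
Qed.
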